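(* The linearization of the indefinite special Lagrangian operator at any solution $u$ of the equation $$\mathrm{Im}\{\det(I+i\,\mathrm{Hess}(u)I_{k,m})\}=0,$$ namely $$L_u(v)=\mathrm{Im}\,\frac{d}{dt}\det\{I+i\,\mathrm{Hess}(u)I_{k,m}+it\,\mathrm{Hess}(v)I_{k,m}\}\Big|_{t=0},$$ is a homogeneous second order partial differential operator $$L_u(v)=\sum_{i,j}a^{ij}(\partial^2u)\frac{\partial^2v}{\partial x_i\partial x_j},$$ where $(a^{ij}(\partial^2u))$ is a non-degenerate symmetric matrix with index $k$ at each point.
   Context: Here $u$ and $v$ are smooth real-valued functions on $\mathbb{R}^m$, $\mathrm{Hess}(u)=(u_{x_ix_j})$ is the Hessian matrix, $I$ is the $m\times m$ identity matrix, and $I_{k,m}=\mathrm{diag}(-1,\dots,-1,1,\dots,1)$ with $k$ entries equal to $-1$ and $m-k$ entries equal to $1$. The index of a non-degenerate real symmetric matrix is its number of negative eigenvalues. The operator being linearized is $u\mapsto\mathrm{Im}\{\det(I+i\,\mathrm{Hess}(u)I_{k,m})\}$.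
   Formalization: Non-degeneracy and index are asserted only at points where D = det(I+i Hess(u) I_{k,m}) is nonzero; there the matrix (a^{ij}) has index k if D>0, while if D<0 it is -(a^{ij}) that has index k. The literal claim fails for u=x1x2 (m=3, k=1) and u=(√3/2)|x|² (m=3, k=0). *)

(* Defs.v *)
From HB Require Import structures.
From mathcomp Require Import all_boot all_order all_algebra.
From mathcomp Require Import all_classical all_reals all_analysis.
From mathcomp Require Import complex.

Set Implicit Arguments.
Unset Strict Implicit.
Unset Printing Implicit Defensive.

Import Order.TTheory GRing.Theory Num.Theory.
Import numFieldNormedType.Exports.

Local Open Scope classical_set_scope.
Local Open Scope ring_scope.

Section Defs.
Context {R : realType} {m : nat}.
Implicit Types (u v f : 'rV[R]_m -> R) (x : 'rV[R]_m) (k : nat).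

Definition partial (i : 'I_m) f : 'rV[R]_m -> R :=
  fun x => 'D_(delta_mx 0 i) f x.

(* [derive] is a total function, so the existence of the partial derivatives
   is required separately. *)
Fixpoint Ck (n : nat) f : Prop :=
  continuous f /\
  if n is n'.+1 then
    forall i : 'I_m,
      (forall x, derivable f x (delta_mx 0 i)) /\ Ck n' (partial i f)
  else True.

Definition smooth f : Prop := forall n, Ck n f.

Definition Hess f x : 'M[R]_m :=
  \matrix_(i, j) partial j (partial i f) x.

Definition Ikm k : 'M[R]_m :=
  diag_mx (\row_(j < m) if (j < k)%N then -1 else 1).

Definition toC (A : 'M[R]_m) : 'M[R[i]]_m := map_mx (real_complex R) A.

Definition slag_mx k u x : 'M[R[i]]_m :=
  1%:M + 'i%C *: (toC (Hess u x) *m toC (Ikm k)).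

Definition slag_op k u x : R := complex.Im (\det (slag_mx k u x)).

Definition deriveC (F : R -> R[i]) (t : R) : R[i] :=
  Complex ((fun s => complex.Re (F s))^`()%classic t)
          ((fun s => complex.Im (F s))^`()%classic t).

Definition slag_lin k u v x : R :=
  complex.Im (deriveC (fun t : R =>
    \det (slag_mx k u x
          + ('i%C * t%:C%C) *: (toC (Hess v x) *m toC (Ikm k)))) 0).

(* [s] lists the eigenvalues of [A] with their multiplicities; it exists, and
   is unique up to permutation, when [A] is symmetric. *)
Definition has_index (A : 'M[R]_m) k : Prop :=
  exists s : seq R,
    char_poly A = \prod_(l <- s) ('X - l%:P) /\ count (fun l => l < 0) s = k.

End Defs.

(* Main.v *)
(* Write J = I_{k,m}, H = Hess u and M = I + iHJ = (J + iH) J, so J^2 = 1. By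
   Jacobi's formula the linearization at u is given by a = Re (J adj M). Where
   det M = d is real and nonzero, a = d Re C for the complex symmetric matrix
   C = J M^-1 = (J + iH)^-1, and
     Re C = C ((conj (C^-1) + C^-1) / 2) conj C = C J C^*,
   so a / d is Hermitian congruent to J and Sylvester's law of inertia gives it
   index k. The symmetry of H is Schwarz's theorem on mixed partials. *)
Require Import Defs.
From mathcomp Require Import all_boot all_order all_algebra.
From mathcomp Require Import all_classical all_reals all_analysis.
From mathcomp Require Import complex.
Set Implicit Arguments.
Unset Strict Implicit.
Unset Printing Implicit Defensive.
Import Order.TTheory GRing.Theory Num.Theory.
Import numFieldNormedType.Exports.
Local Open Scope ring_scope.
Local Open Scope sesquilinear_scope.

(** * Sylvester's law of inertia for diagonal forms *)

Section Inertia.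
Variables (C : numClosedFieldType) (n : nat).
Implicit Types (D E : 'rV[C]_n) (Q : 'M[C]_n) (u : 'rV[C]_n).

Lemma diag_form D u :
  (u *m diag_mx D *m u ^t*) 0 0 = \sum_i D 0 i * `|u 0 i| ^+ 2.
Proof.
rewrite mxE; apply: eq_bigr => i _.
rewrite mul_mx_diag !mxE normCK. by rewrite mulrCA -mulrA.
Qed.

(* A vector killed by both families of coordinate constraints would make the
   form negative in the coordinates of [D] and nonnegative in those of [E], so
   these constraints must number at least [n]. *)
Lemma inertia_le D E Q : diag_mx D = Q *m diag_mx E *m Q ^t* ->
  (n <= #|[pred i | ~~ (D ord0 i < 0)%R]| + #|[pred j | ~~ (0 <= E ord0 j)%R]|)%N.
Proof.
move=> DQE; set P1 := [pred i | _]; set P2 := [pred j | _].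
rewrite leqNgt; apply/negP => small.
pose f (i : 'I_#|P1|) : 'I_n := enum_val i.
pose g (j : 'I_#|P2|) : 'I_n := enum_val j.
pose K := row_mx (colsub f (1%:M : 'M[C]_n)) (colsub g Q).
have kerK : kermx K != 0.
  rewrite -mxrank_eq0 mxrank_ker -lt0n subn_gt0.
  exact: leq_ltn_trans (rank_leq_col K) small.
have [u /sub_kermxP uK un0] := rowV0Pn kerK.
move: uK; rewrite mul_mx_row -row_mx0 => /eq_row_mx[u1 u2].
have uf i : ~~ (D 0 i < 0) -> u 0 i = 0.
  move=> Di; have Pi : i \in P1 by [].
  move/rowP: u1 => /(_ (enum_rank_in Pi i)).
  rewrite mulmx_colsub mulmx1 !mxE /f enum_rankK_in //.
have ug j : ~~ (0 <= E 0 j) -> (u *m Q) 0 j = 0.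
  move=> Ej; have Pj : j \in P2 by [].
  move/rowP: u2 => /(_ (enum_rank_in Pj j)).
  by rewrite mulmx_colsub [in LHS]mxE [in RHS]mxE /g enum_rankK_in.
have neg : \sum_i D 0 i * `|u 0 i| ^+ 2 < 0.
  have [i ui0] : exists i, u 0 i != 0 by apply/rV0Pn.
  have Dle j : D 0 j * `|u 0 j| ^+ 2 <= 0.
    have [/ltW Dj|/uf->] := boolP (D 0 j < 0); last by rewrite normr0 expr0n mulr0.
    by rewrite mulr_le0_ge0 // exprn_ge0.
  rewrite (bigD1 i) //= ltr_wnDr ?sumr_le0 //.
  have Di : D 0 i < 0 by apply: contraNT ui0 => /uf->.
  by rewrite pmulr_llt0 // exprn_gt0 // normr_gt0.
have pos : 0 <= \sum_i D 0 i * `|u 0 i| ^+ 2.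
  (* The form of [D] at [u] is the form of [E] at [u *m Q]. *)
  rewrite -diag_form DQE !mulmxA -mulmxA -map_mxM -trmx_mul diag_form.
  apply: sumr_ge0 => j _.
  have [Ej|/ug->] := boolP (0 <= E 0 j); last by rewrite normr0 expr0n mulr0.
  by rewrite mulr_ge0 // exprn_ge0.
by have := lt_le_trans neg pos; rewrite ltxx.
Qed.

(** After complementing, [inertia_le] bounds the negative count of [D] by that of [E]; reality is
    what turns not nonnegative into negative in the partial order of [C]. Congruence by [invmx Q]
    gives the reverse bound. *)
Lemma sylvester_inertia D E Q : D \is a realmx -> E \is a realmx ->
  Q \in unitmx -> diag_mx D = Q *m diag_mx E *m Q ^t* ->
  #|[pred i | (D ord0 i < 0)%R]| = #|[pred i | (E ord0 i < 0)%R]|.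
Proof.
have key D' E' Q' : E' \is a realmx -> diag_mx D' = Q' *m diag_mx E' *m Q' ^t* ->
    (#|[pred i | (D' ord0 i < 0)%R]| <= #|[pred i | (E' ord0 i < 0)%R]|)%N.
  move=> /mxOverP Er /inertia_le le_n.
  have := cardC [pred i | (D' ord0 i < 0)%R]; rewrite card_ord.
  rewrite [X in (_ + X)%N = _](_ : _ = #|[pred i | ~~ (D' ord0 i < 0)%R]|); last exact: eq_card.
  rewrite [X in (_ <= _ + X)%N](_ : _ = #|[pred i | (E' ord0 i < 0)%R]|) in le_n; last first.
    by apply: eq_card => j; rewrite !inE real_leNgt ?negbK // real0.
  by move=> eq_n; rewrite -[X in (X <= _ + _)%N]eq_n addnC leq_add2l in le_n.
move=> Dr Er Qu DQE; apply/eqP; rewrite eqn_leq (key _ _ _ Er DQE) /=.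
apply: (key E D (invmx Q) Dr).
rewrite DQE !mulmxA mulVmx // mul1mx -mulmxA -map_mxM -trmx_mul mulVmx //.
by rewrite trmx1 map_mx1 mulmx1.
Qed.
End Inertia.

(** * Reading the index off a congruence *)

Lemma simmx_char_poly (F : fieldType) n (P A B : 'M[F]_n) : P \in unitmx ->
  A = invmx P *m B *m P -> char_poly A = char_poly B.
Proof.
move=> Pu ->; rewrite /char_poly.
rewrite (_ : char_poly_mx _ =
  map_mx polyC (invmx P) *m char_poly_mx B *m map_mx polyC P); last first.
  rewrite /char_poly_mx mulmxBr mulmxBl !map_mxM.
  by rewrite scalar_mxC -(mulmxA _%:M) -(map_mxM polyC (invmx P) P) mulVmx // map_mx1 mulmx1.
rewrite !det_mulmx mulrAC -det_mulmx. rewrite -map_mxM mulVmx //.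
by rewrite map_mx1 det1 mul1r.
Qed.
(** The spectral theorem diagonalises [A] by a unitary [P], whose diagonal [D] supplies the
    eigenvalue list. Since [D] is [P A P^*], it is congruent to [e] through [P *m S], and
    Sylvester's law equates the numbers of negative entries. *)
Lemma has_index_congr (R : realType) n (A : 'M[R]_n) (e : 'rV[R]_n)
    (S : 'M[R[i]]_n) : A^T = A -> S \in unitmx ->
  toC A = S *m diag_mx (map_mx (real_complex R) e) *m S ^t* ->
  has_index A #|[pred i | e ord0 i < 0]|.
Proof.
move=> Asym Su AS; set B := toC A.
have Bsym : B \is symmetricmx.
  by apply/is_hermitianmxP; rewrite expr0 scale1r map_mx_id // /B /toC map_trmx Asym.
have Breal : B \is a realmx.
  by apply/mxOverP => i j; rewrite mxE; apply/complex_realP; exists (A i j).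
have Bherm : B \is hermsymmx by apply: realsym_hermsym.
have Bnorm := hermitian_normalmx Bherm.
have Dreal := hermitian_spectral_diag_real Bherm.
have /orthomx_spectralP BD := Bnorm.
set P := spectralmx B in BD; set D := spectral_diag B in BD Dreal.
have Pu : P \in unitmx := spectral_unit B.
pose d : 'rV[R]_n := map_mx (@complex.Re R) D.
have dE i : D 0 i = (d 0 i)%:C%C.
  by rewrite mxE RRe_real //; move/mxOverP: Dreal; apply.
exists [seq d ord0 i | i <- enum 'I_n]; split.
  apply: (map_poly_inj (real_complex R)).
  rewrite map_char_poly -/(toC A) -/B (simmx_char_poly Pu BD).
  rewrite char_poly_trig ?diag_mx_is_trig // rmorph_prod /= big_map big_enum /=.
  apply: eq_bigr => i _.
  by rewrite mxE eqxx mulr1n dE rmorphB /= map_polyX map_polyC.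
transitivity #|[pred i | D ord0 i < 0]|.
  rewrite count_map -sum1_count big_enum_cond -sum1_card.
  by apply: eq_bigl => i; rewrite !inE /= dE ltcR.
pose e' := map_mx (real_complex R) e.
rewrite (@sylvester_inertia _ _ D e' (P *m S)) //.
- by apply: eq_card => i; rewrite !inE mxE ltcR.
- by apply/mxOverP => i j; rewrite mxE; apply/complex_realP; exists (e i j).
- by rewrite unitmx_mul Pu.
- rewrite trmx_mul map_mxM !mulmxA.
  rewrite -(mulmxA P S) -(mulmxA P (_ *m _)) -AS -/B BD.
  by rewrite !mulmxA mulmxV // mul1mx -mulmxA -invmx_unitary ?spectral_unitarymx // mulmxV // mulmx1.
Qed.

(** * The adjugate under similarity *)

Lemma adj_conj_nonsing (R : idomainType) n (P P' M : 'M[R]_n) :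
  P *m P' = 1%:M -> \det M != 0 ->
  \adj (P *m M *m P') = P *m \adj M *m P'.
Proof.
move=> PP' M0; have P'P := mulmx1C PP'.
set N := P *m M *m P'.
have detN : \det N = \det M.
  by rewrite !det_mulmx mulrAC -det_mulmx PP' det1 mul1r.
have NK : N *m (P *m \adj M *m P') = (\det M)%:M.
  rewrite /N !mulmxA -(mulmxA _ P' P) P'P mulmx1 -(mulmxA P) mul_mx_adj.
  by rewrite scalar_mxC -mulmxA PP' mulmx1.
(* Associating the product of [\adj N], [N] and [P *m \adj M *m P'] in both ways gives the claim
   times [\det M], which cancels in a domain. *)
have : \det M *: \adj N = \det M *: (P *m \adj M *m P').
  by rewrite -mul_mx_scalar -NK (mulmxA (\adj N) N) mul_adj_mx detN mul_scalar_mx.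
move=> eqdet; apply/matrixP => i j; apply: (mulfI M0).
by move/matrixP: eqdet => /(_ i j); rewrite !mxE.
Qed.

(* A singular [M] is reached by specialising the nonsingular ['X + M] at 0. *)
Lemma adj_conj (R : idomainType) n (P P' M : 'M[R]_n) :
  P *m P' = 1%:M -> \adj (P *m M *m P') = P *m \adj M *m P'.
Proof.
move=> PP'; pose MX := char_poly_mx (- M).
have ev (A : 'M[R]_n) : map_mx (horner_eval 0) (map_mx polyC A) = A.
  by apply/matrixP => i j; rewrite !mxE /horner_eval hornerC.
have evMX : map_mx (horner_eval 0) MX = M.
  apply/matrixP => i j; rewrite !mxE /horner_eval !hornerE.
  by case: (i == j); rewrite ?mulr1n ?mulr0n !hornerE ?oppr0 ?add0r opprK.
have PP'X : map_mx polyC P *m map_mx polyC P' = 1%:M.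
  by rewrite -map_mxM PP' map_mx1.
have MX0 : \det MX != 0 by apply: monic_neq0; apply: char_poly_monic.
have /(congr1 (map_mx (horner_eval 0))) := adj_conj_nonsing PP'X MX0.
by rewrite map_mx_adj !map_mxM map_mx_adj !ev evMX.
Qed.

Lemma card_ltn_ord m k : (k <= m)%N -> #|[pred i : 'I_m | (i < k)%N]| = k.
Proof.
by move=> km; rewrite -sum1_card (big_ord_narrow km) sum1_card card_ord.
Qed.

(** Noncommutative form of [1/a + 1/b = (a + b)/(ab)]. It serves for [M] and its conjugate, whose
    sum is the scalar 2. *)
Lemma invmxD (R : comUnitRingType) n (A B : 'M[R]_n) :
  A \in unitmx -> B \in unitmx ->
  invmx A + invmx B = invmx A *m ((A + B) *m invmx B).
Proof.
move=> Au Bu; rewrite mulmxDl mulmxDr (mulmxV Bu) mulmx1 mulmxA (mulVmx Au).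
by rewrite mul1mx addrC.
Qed.

(** * The coefficient matrix: symmetry and congruence to the signs *)

Section Symbol.
Context {R : realType} {m : nat}.
Variable k : nat.
Implicit Types (H : 'M[R]_m).
Local Notation C := R[i].
Local Notation J := (toC (Ikm k) : 'M[C]_m).

Definition slag_of H : 'M[C]_m := 1%:M + 'i%C *: (toC H *m J).

(** The determinant is differentiated in the direction [i V J] with [V] real: cyclicity of the trace
    moves [J] in front of the adjugate, and the factor [i] turns the imaginary part into a real
    part. *)
Definition lin_coef H : 'M[R]_m :=
  map_mx (@complex.Re R) (J *m \adj (slag_of H)).

Definition signs : 'rV[R]_m := \row_(j < m) if (j < k)%N then -1 else 1.

Lemma Ikm_sqr : (Ikm k : 'M[R]_m) *m Ikm k = 1%:M.
Proof.
rewrite mulmx_diag; apply/matrixP => i j; rewrite !mxE.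
by case: ifP; rewrite ?mulrNN mulr1.
Qed.

Lemma toC_Ikm_sqr : J *m J = 1%:M.
Proof. by rewrite /toC -map_mxM Ikm_sqr map_mx1. Qed.

Lemma tr_toC_Ikm : J^T = J.
Proof. by rewrite /toC map_trmx tr_diag_mx. Qed.

(** Transposition swaps [H J] into [J H], so [M^T = J M J], and the adjugate follows this similarity
    even where [M] is singular; symmetry thus holds at every point. *)
Lemma tr_Ikm_adj_slag H : H^T = H ->
  (J *m \adj (slag_of H))^T = J *m \adj (slag_of H).
Proof.
move=> Hsym; have trS : (slag_of H)^T = J *m slag_of H *m J.
  rewrite /slag_of linearD linearZ /= trmx1 trmx_mul tr_toC_Ikm.
  rewrite [(toC H)^T]map_trmx Hsym mulmxDr mulmxDl mulmx1 toC_Ikm_sqr.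
  rewrite -scalemxAr -scalemxAl. by rewrite !mulmxA -(mulmxA _ J J) toC_Ikm_sqr mulmx1.
rewrite trmx_mul trmx_adj trS tr_toC_Ikm (adj_conj _ toC_Ikm_sqr).
by rewrite -(mulmxA _ J J) toC_Ikm_sqr mulmx1.
Qed.

Lemma tr_lin_coef H : H^T = H -> (lin_coef H)^T = lin_coef H.
Proof. by move=> Hsym; rewrite /lin_coef map_trmx tr_Ikm_adj_slag. Qed.

Lemma toC_Re_mx (A : 'M[C]_m) :
  2%:R *: toC (map_mx (@complex.Re R) A) = A + map_mx Num.conj A.
Proof. by apply/matrixP => i j; rewrite !mxE -addcJ. Qed.

Lemma conj_real_complex (x : R) : (x%:C%C)^* = x%:C%C :> C.
Proof. by apply/CrealP/complex_realP; exists x. Qed.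

(* The witness is [S = J M^-1 = (J + iH)^-1]; it is symmetric, so [S^*] is its
   entrywise conjugate and [S J S^*] is its real part. *)
Lemma lin_coef_congr H (d : R) : H^T = H -> d != 0 ->
  \det (slag_of H) = d%:C%C ->
  exists2 S : 'M[C]_m, S \in unitmx &
    toC (lin_coef H) = S *m diag_mx (map_mx (real_complex R) (d *: signs)) *m S ^t*.
Proof.
move=> Hsym d0 detS; set M := slag_of H in detS.
have dC0 : d%:C%C != 0 :> C by rewrite fmorph_eq0.
have Mu : M \in unitmx by rewrite unitmxE detS unitfE.
have Ju : J \in unitmx by have /mulmx1_unit[] := toC_Ikm_sqr.
pose S := J *m invmx M.
have adjS : J *m \adj M = d%:C%C *: S.
  by rewrite /S /invmx Mu detS -scalemxAr scalerA mulfV // scale1r.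
have Ssym : S^T = S.
  apply: (scalerI dC0); rewrite -[RHS]adjS -(tr_Ikm_adj_slag Hsym).
  by rewrite -/M adjS linearZ.
(* Each entry of [M - 1] is [i] times a real number, so conjugation just negates it. *)
have conjM : map_mx Num.conj M = 2%:R *: 1%:M - M.
  rewrite /M /slag_of -map_mxM; apply/matrixP => i j; rewrite !mxE.
  rewrite rmorphD rmorph_nat /=.
  have iJ (x : R) : ('i%C * x%:C%C)^* = - ('i%C * x%:C%C) :> C.
    rewrite rmorphM -mulNr /=; congr (_ * _); first by rewrite [LHS]/(conjc _); simpc.
    exact: conj_real_complex.
  rewrite [X in _ + X](iJ _).
  by rewrite mulr_natl mulr2n opprD addrA addrK.
have cMu : map_mx Num.conj M \in unitmx by rewrite (map_unitmx _ M); exact Mu.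
have conjS : map_mx Num.conj S = J *m invmx (map_mx Num.conj M).
  rewrite map_mxM map_invmx; congr (_ *m _).
  apply/matrixP => i j; rewrite !mxE; exact: conj_real_complex.
exists S; first by rewrite unitmx_mul Ju unitmx_inv; exact Mu.
have two0 : 2%:R != 0 :> C by rewrite pnatr_eq0.
(* Doubling replaces the real part by the sum of a matrix and its conjugate, to which [invmxD]
   applies. *)
apply: (scalerI two0).
rewrite /lin_coef -/M adjS toC_Re_mx map_mxZ.
rewrite /= conj_real_complex.
rewrite Ssym.
rewrite (_ : diag_mx _ = d%:C%C *: J); last first.
  by rewrite -map_diag_mx -map_mxZ; congr map_mx; rewrite -linearZ.
rewrite -scalemxAr -scalemxAl scalerA mulrC -scalerA -scalerDr; congr (_ *: _).
rewrite conjS !mulmxA -(mulmxA (J *m _) J J) toC_Ikm_sqr mulmx1.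
rewrite -!mulmxA -mulmxDr scalemxAr; congr (_ *m _).
rewrite scalemxAr -[X in _ *: X]mul1mx scalemxAl.
rewrite (_ : 2%:R *: _ = M + map_mx Num.conj M); last by rewrite conjM addrC subrK.
exact (invmxD Mu cMu).
Qed.
End Symbol.

(** * Derivative of a determinant along a line of matrices *)

Lemma deriv_prod (R : comNzRingType) (I : eqType) (r : seq I) (f : I -> {poly R}) :
  uniq r ->
  (\prod_(i <- r) f i)^`()
  = \sum_(i <- r) (f i)^`() * \prod_(j <- r | j != i) f j.
Proof.
elim: r => [|x r IHr] /=; first by rewrite !big_nil derivC.
case/andP=> xr ur; rewrite !big_cons derivM IHr // eqxx /=; congr (_ * _ + _).
  rewrite big_seq [RHS]big_seq_cond; apply: eq_bigl => j.
  by case jr: (j \in r) => //=; apply/esym; apply: contraNneq xr => <-.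
rewrite big_distrr big_seq [RHS]big_seq; apply: eq_bigr => i ir /=.
rewrite big_cons; have -> : x != i by apply: contraNneq xr => ->.
by rewrite mulrCA.
Qed.

Section DetLine.
Variables (R : comNzRingType) (n : nat) (M N : 'M[R]_n).

(** As a polynomial in the line parameter, the determinant can be differentiated algebraically. *)
Definition det_line : {poly R} := \det (map_mx polyC M + 'X *: map_mx polyC N).

Lemma horner_det_line t : det_line.[t] = \det (M + t *: N).
Proof.
rewrite -/(horner_eval t det_line) -det_map_mx; congr (\det _).
apply/matrixP => i j; by rewrite !mxE /= /horner_eval !hornerE.
Qed.

(** Jacobi's formula. Differentiating the Leibniz expansion factor by factor replaces one row of [M]
    by that of [N] at a time; expanding along the replaced row leaves the cofactors of [M]. *)
Lemma deriv_det_line0 :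
  det_line^`().[0] = \sum_i \sum_j N i j * cofactor M i j.
Proof.
pose M' i := \matrix_(j, l) if j == i then N j l else M j l.
transitivity (\sum_i \det (M' i)); last first.
  apply: eq_bigr => i _; rewrite (expand_det_row _ i); apply: eq_bigr => j _.
  rewrite mxE eqxx; congr (_ * _); rewrite /cofactor; congr (_ * \det _).
  by apply/matrixP => p q; rewrite !mxE eq_sym (negPf (neq_lift _ _)).
rewrite /det_line /determinant exchange_big /= raddf_sum /= horner_sum.
apply: eq_bigr => s _; rewrite -big_distrr /=.
have sgnE (b : bool) : (-1) ^+ b = ((-1) ^+ b)%:P :> {poly R}.
  by rewrite rmorphXn /= rmorphN1.
rewrite sgnE mul_polyC derivZ hornerZ; congr (_ * _).
rewrite deriv_prod ?index_enum_uniq // horner_sum; apply: eq_bigr => i _.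
rewrite hornerM horner_prod [RHS](bigD1 i) //= !mxE eqxx; congr (_ * _).
  by rewrite derivD derivC add0r derivM derivX derivC mulr0 addr0 mul1r hornerC.
apply: eq_bigr => j ji; rewrite !mxE (negPf ji).
by rewrite hornerD hornerC hornerM hornerX mul0r addr0.
Qed.
End DetLine.

(** On the real line a complex polynomial is [re + i im] with [re] and [im] real polynomials, so the
    analytic derivative of each part is the formal one. *)
Lemma deriveC_horner (R : realType) (p : {poly R[i]}) (t : R) :
  deriveC (fun s : R => p.[s%:C%C]) t = p^`().[t%:C%C].
Proof.
pose re := \poly_(i < size p) complex.Re p`_i.
pose im := \poly_(i < size p) complex.Im p`_i.
have pE : p = map_poly (real_complex R) re + 'i%C *: map_poly (real_complex R) im.
  by apply/polyP => i; rewrite coefD coefZ !coef_map; exact: complexE.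
have hE (q r : {poly R}) (s : R) :
    (map_poly (real_complex R) q + 'i%C *: map_poly (real_complex R) r).[s%:C%C]
    = Complex q.[s] r.[s].
  by rewrite hornerD hornerZ !horner_map [RHS]complexE.
rewrite [in RHS]pE derivD derivZ !deriv_map hE /deriveC pE.
by congr Complex; rewrite derivE; congr (_^`()%classic t); apply/funext => s;
  rewrite hE.
Qed.

(** * Schwarz's theorem on mixed derivatives *)

Section Schwarz.
Context {R : realType} {m : nat}.
Implicit Types (f : 'rV[R]_m -> R) (x w : 'rV[R]_m).

Lemma is_derive_line f x w (t : R) : derivable f (x + t *: w) w ->
  is_derive t 1 (fun s : R => f (x + s *: w)) ('D_w f (x + t *: w)).
Proof.
move=> df.
have E : (fun h : R => h^-1 *: (((fun s : R => f (x + s *: w)) \o shift t) (h *: 1) -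
            f (x + t *: w)))
  = (fun h : R => h^-1 *: ((f \o shift (x + t *: w)) (h *: w) - f (x + t *: w))).
  apply/funext => h /=; rewrite [h *: 1]mulr1 scalerDl.
  by rewrite addrCA addrA.
by split; rewrite /derivable /derive /= E.
Qed.

Lemma MVT_line f x w (h : R) : 0 < h -> (forall y, derivable f y w) ->
  exists2 c, 0 < c < h & f (x + h *: w) - f x = 'D_w f (x + c *: w) * h.
Proof.
move=> h0 df; pose g s := f (x + s *: w).
have dg (s : R) : is_derive s (1 : R) g ('D_w f (x + s *: w)) by exact: is_derive_line.
have [|c c_in] := @MVT R g (fun s => 'D_w f (x + s *: w)) 0 h h0 (fun s _ => dg s).
  apply: derivable_within_continuous => s _; exact: ex_derive.
rewrite /g scale0r addr0 subr0 => gE; by exists c; rewrite -?gE ?in_itv.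
Qed.

(** The mean value theorem is used along [v] for the increment [g] of [f] in direction [w], then
    along [w] for ['D_v f]. The left side is symmetric in [v] and [w], the right side is not. *)
Lemma second_difference f (v w : 'rV[R]_m) x (h : R) : 0 < h ->
  (forall y, derivable f y v) -> (forall y, derivable ('D_v f) y w) ->
  exists s t : R, [/\ 0 < s < h, 0 < t < h &
    f (x + h *: v + h *: w) - f (x + h *: v) - (f (x + h *: w) - f x)
    = 'D_w ('D_v f) (x + s *: v + t *: w) * h * h].
Proof.
move=> h0 dv dw; pose g y := f (y + h *: w) - f y.
have quotE y : (fun r : R => r^-1 *: (f (r *: v + y + h *: w) - f (y + h *: w)))
    = (fun r : R => r^-1 *: (f (r *: v + (y + h *: w)) - f (y + h *: w))).
  by apply/funext => r; rewrite addrA.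
have dfw y : derivable (fun z => f (z + h *: w)) y v.
  by have := dv (y + h *: w); rewrite /derivable /= quotE.
have Dfw y : 'D_v (fun z => f (z + h *: w)) y = 'D_v f (y + h *: w).
  by rewrite /derive /= quotE.
have dg y : derivable g y v by apply: derivableB.
have [s s_in gE] := MVT_line x h0 dg.
have [t t_in DE] := MVT_line (x + s *: v) h0 dw.
exists s, t; split => //.
rewrite -DE -[LHS]/(_ - _).
transitivity (g (x + h *: v) - g x); first by [].
rewrite gE; congr (_ * _).
by rewrite /g deriveB // Dfw.
Qed.

End Schwarz.

Lemma sub_subAC (V : zmodType) (a b c d : V) : a - b - (c - d) = a - c - (b - d).
Proof. by rewrite !opprB addrACA [RHS]addrACA; congr (_ + _); exact: addrC. Qed.

Lemma dist_half_le (R : realFieldType) (a b c d e : R) :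
  `|a - c| < e / 2 -> `|b - d| < e / 2 -> c = d -> `|a - b| <= e.
Proof.
move=> ac bd cd; apply: (le_trans (ler_distD c _ _)).
by rewrite (splitr e) lerD ?ltW // cd distrC.
Qed.

(** The same second difference, taken in both orders, is [h * h] times either mixed derivative at
    some point near [x]. One [h] small enough for both continuity estimates then puts the two values
    at [x] within any [e]. *)
Lemma schwarz (R : realType) (m : nat) (f : 'rV[R]_m -> R) (v w x : 'rV[R]_m) :
  (forall y, derivable f y v) -> (forall y, derivable f y w) ->
  (forall y, derivable ('D_v f) y w) -> (forall y, derivable ('D_w f) y v) ->
  {for x, continuous ('D_w ('D_v f))} -> {for x, continuous ('D_v ('D_w f))} ->
  'D_w ('D_v f) x = 'D_v ('D_w f) x.
Proof.
move=> dv dw dvw dwv cvw cwv.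
have near_line (g : 'rV[R]_m -> R) (a b : 'rV[R]_m) (e : R) : 0 < e ->
    {for x, continuous g} ->
    exists2 d : R, 0 < d & forall s t, 0 < s < d -> 0 < t < d ->
      `|g x - g (x + s *: a + t *: b)| < e.
  move=> e0 cg.
  pose G (p : R * R) := g (x + p.1 *: a + p.2 *: b).
  have cG : {for (0, 0), continuous G}.
    rewrite /G; apply: (@continuous_comp _ _ _ (fun p : R * R => x + p.1 *: a + p.2 *: b) g).
      apply: cvgD; last by apply: cvgZl; exact: cvg_snd.
      apply: cvgD; first exact: cvg_cst.
      by apply: cvgZl; exact: cvg_fst.
    by rewrite /= !scale0r !addr0.
  have /cvgr_dist_lt /(_ e e0) := cG.
  rewrite /G /= !scale0r !addr0 => /nbhs_ballP[d /= d0 dG]; exists d => // s t sd td.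
  apply: (dG (s, t)); split; rewrite /ball /= sub0r normrN gtr0_norm;
    by case/andP: sd td => ? ? /andP[].
apply/eqP; rewrite -subr_eq0 -normr_le0; apply/ler_addgt0Pl => e e0.
rewrite addr0.
have e2 : 0 < e / 2 by rewrite divr_gt0.
have [d1 d10 near1] := near_line _ v w _ e2 cvw.
have [d2 d20 near2] := near_line _ w v _ e2 cwv.
pose h := Num.min d1 d2.
have h0 : 0 < h by rewrite lt_min d10.
have [s [t [/andP[s0 sh] /andP[t0 th] E1]]] := second_difference x h0 dv dvw.
have [s' [t' [/andP[s'0 s'h] /andP[t'0 t'h] E2]]] := second_difference x h0 dw dwv.
have h1 : h <= d1 by rewrite ge_min lexx.
have h2 : h <= d2 by rewrite ge_min lexx orbT.
have st : `|'D_w ('D_v f) x - 'D_w ('D_v f) (x + s *: v + t *: w)| < e / 2.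
  by apply: near1; rewrite ?s0 ?t0 /=; apply: lt_le_trans h1.
have st' : `|'D_v ('D_w f) x - 'D_v ('D_w f) (x + s' *: w + t' *: v)| < e / 2.
  by apply: near2; rewrite ?s'0 ?t'0 /=; apply: lt_le_trans h2.
have E : 'D_w ('D_v f) (x + s *: v + t *: w)
       = 'D_v ('D_w f) (x + s' *: w + t' *: v).
  apply: (mulIf (lt0r_neq0 h0)); apply: (mulIf (lt0r_neq0 h0)).
  have vw : x + h *: v + h *: w = x + h *: w + h *: v by exact: addrAC.
  rewrite vw in E1.
  by apply: (etrans (esym E1)); apply: (etrans _ E2); exact: sub_subAC.
exact: dist_half_le st st' E.
Qed.

(** * Symmetry of the Hessian, the linearization formula and its index *)

Lemma tr_Hess (R : realType) (m : nat) (u : 'rV[R]_m -> R) (x : 'rV[R]_m) :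
  smooth u -> (Hess u x)^T = Hess u x.
Proof.
move=> /(_ 2) [_ u2]; apply/matrixP => i j; rewrite !mxE.
have d1 l : forall y, derivable u y (delta_mx 0 l) by case: (u2 l).
have d2 l l' : (forall y, derivable (partial l u) y (delta_mx 0 l')) /\
    continuous (partial l' (partial l u)).
  by case: (u2 l) => _ [_ /(_ l')[? []]].
have [dji cji] := d2 j i; have [dij cij] := d2 i j.
exact: (schwarz (d1 j) (d1 i) dji dij (cji x) (cij x)).
Qed.

(** Jacobi's formula pairs the [(i, j)] entry of [Hess v] with [J j j * cofactor M i j], which is
    the [(j, i)] entry of [J *m \adj M]; hence the transpose. *)
Lemma slag_lin_sum (R : realType) (m k : nat) (u v : 'rV[R]_m -> R) (x : 'rV[R]_m) :
  slag_lin k u v x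
  = \sum_(i < m) \sum_(j < m) (lin_coef k (Hess u x))^T i j * Hess v x i j.
Proof.
pose N := 'i%C *: (toC (Hess v x) *m toC (Ikm k)) : 'M[R[i]]_m.
rewrite /slag_lin (_ : (fun t : R => _)
    = fun t : R => (det_line (slag_mx k u x) N).[t%:C%C]); last first.
  by apply/funext => t; rewrite horner_det_line scalerA (mulrC 'i%C).
rewrite deriveC_horner rmorph0 deriv_det_line0 raddf_sum /=.
apply: eq_bigr => i _; rewrite raddf_sum /=; apply: eq_bigr => j _.
rewrite /N /lin_coef /toC !map_diag_mx mul_mx_diag mul_diag_mx !mxE.
rewrite -mulrA mulrC ImiRe -mulrA.
set c := (if _ then _ else _).
set z := cofactor _ _ _.
rewrite -/(slag_mx k u x).
by case: z => p q /=; rewrite !mul0r !subr0 mulrC.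
Qed.

(** The congruence passes through [M^-1], hence the nonvanishing determinant. The real factor [d]
    scales the signs of [J], so its own sign decides whether [a] or [-a] has index [k]. *)
Theorem theorem3p5 (R : realType) (m k : nat) (hk : (k <= m)%N) :
  exists a : 'M[R]_m -> 'M[R]_m,
  forall u : 'rV[R]_m -> R, smooth u ->
    (forall x : 'rV[R]_m, slag_op k u x = 0) ->
    [/\ forall (v : 'rV[R]_m -> R), smooth v -> forall x : 'rV[R]_m,
          slag_lin k u v x
          = \sum_(i < m) \sum_(j < m) a (Hess u x) i j * Hess v x i j,
        forall x : 'rV[R]_m, (a (Hess u x))^T = a (Hess u x)
      & forall x : 'rV[R]_m, \det (slag_mx k u x) != 0 ->
          [/\ a (Hess u x) \in unitmx,
              0 < complex.Re (\det (slag_mx k u x)) ->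
                has_index (a (Hess u x)) k
            & complex.Re (\det (slag_mx k u x)) < 0 ->
                has_index (- a (Hess u x)) k]].
Proof.
exists (lin_coef k) => u su opu; have Hsym x := tr_Hess x su.
have Asym x := tr_lin_coef k (Hsym x).
split=> // [v _ x|x det0]; first by rewrite slag_lin_sum Asym.
have := opu x; rewrite /slag_op; set d := complex.Re _ => det_im.
(* The equation removes the imaginary part, so the determinant is the real number [d]. *)
have detE : \det (slag_of k (Hess u x)) = d%:C%C.
  by rewrite [LHS]complexE -/(slag_mx k u x) det_im rmorph0 mulr0 addr0.
have d0 : d != 0 by move: det0; rewrite -/(slag_of k (Hess u x)) detE fmorph_eq0.
have [S Su AS] := lin_coef_congr (Hsym x) d0 detE.
have card_neg (c : R) : 0 < c ->
    #|[pred i : 'I_m | (c *: signs k : 'rV[R]_m) ord0 i < 0]| = k.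
  move=> c0; rewrite -[RHS](card_ltn_ord hk); apply: eq_card => i.
  rewrite !inE !mxE; case: ifP => _; rewrite pmulr_rlt0 ?ltrN10 //.
  by rewrite ltr10.
split.
- rewrite -(map_unitmx (real_complex R)) -/(toC _) AS !unitmx_mul Su.
  rewrite map_unitmx unitmx_tr Su andbT unitmxE det_diag unitfE.
  apply/prodf_neq0 => i _; rewrite !mxE fmorph_eq0 mulf_neq0 //.
  by case: ifP; rewrite ?oppr_eq0 oner_eq0.
- by move=> dpos; have := has_index_congr (Asym x) Su AS; rewrite card_neg.
(* For negative [d] the same [S] makes [-a] congruent to [-d] times the signs, a positive
   multiple. *)
- rewrite -oppr_gt0 => dneg.
  have AN : (- lin_coef k (Hess u x))^T = - lin_coef k (Hess u x).
    by rewrite linearN /= Asym.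
  have := has_index_congr (e := - d *: signs k) AN Su; rewrite card_neg //; apply.
  rewrite /toC map_mxN -/(toC _) AS scaleNr map_mxN linearN /=.
  by rewrite mulmxN mulNmx.
Qed.
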